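(* Let $n,r\ge 1$ be integers, let $w\in \mathbf{F}_r\ast S_n$, and consider the associated word map with constants $w\colon S_n^r\to S_n$, with image $w(S_n^r)$. Then the following holds. (i) If $w$ has non-trivial content, then $$\frac{\operatorname{diam}(w(S_n^r))+1}{n}\ \ge\ \frac12\exp\bigl(-\log(5\ell(w))\,\ell(w)/2\bigr).$$ (ii) If $w$ is strong and $w\notin S_n$, then $$\frac{\operatorname{diam}(w(S_n^r))+1}{n}\ \ge\ \frac{1}{2\ell(w)}.$$ More precisely, if $w\notin S_n$ is arbitrary (not necessarily strong) and the inequality in (ii) is violated, i.e. $\frac{\operatorname{diam}(w(S_n^r))+1}{n}<\frac{1}{2\ell(w)}$, then, writing $w=c_0x_{i(1)}^{\varepsilon(1)}c_1\cdots x_{i(l)}^{\varepsilon(l)}c_l$ in normal form, there is a critical index $j\in\{1,\dots,l-1\}$ (so that removal of the constant $c_j$ leads to cancellation of variables) with $$|c_j|\ \le\ 2\,(\operatorname{diam}(w(S_n^r))+1)\,\ell(w).$$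
   Context: $\mathbf{F}_r=\langle x_1,\dots,x_r\rangle$ is the free group on $x_1,\dots,x_r$, $S_n$ is the symmetric group on $n$ points, and $\ast$ denotes the free product. For a group $G$, an element $w\in\mathbf{F}_r\ast G$ is called a word with constants in $G$. It induces a word map with constants $w\colon G^r\to G$, where $w(g_1,\dots,g_r)$ is the image of $w$ under the unique homomorphism $\mathbf{F}_r\ast G\to G$ that is the identity on $G$ and maps $x_i\mapsto g_i$. Its image is $w(G^r)\subseteq G$. The content of $w$ is $\varepsilon(w)\in\mathbf{F}_r$, the image of $w$ under the homomorphism $\mathbf{F}_r\ast G\to\mathbf{F}_r$ that is the identity on $\mathbf{F}_r$ and maps all of $G$ to the neutral element. Normal form: every $w\in\mathbf{F}_r\ast G$ can be written uniquely as $w=c_0x_{i(1)}^{\varepsilon(1)}c_1\cdots c_{l-1}x_{i(l)}^{\varepsilon(l)}c_l$ with $l\ge 0$, $i(j)\in\{1,\dots,r\}$, $\varepsilon(j)=\pm1$, $c_j\in G$, and without cancellation: if $i(j)=i(j+1)$ and $\varepsilon(j)=-\varepsilon(j+1)$ then $c_j\ne 1_G$ ($1\le j\le l-1$). The length of $w$ is $\ell(w)=l$. An index $j\in\{1,\dots,l-1\}$ is critical if $i(j)=i(j+1)$ and $\varepsilon(j)=-\varepsilon(j+1)$; then $c_j$ is called a critical constant. The word $w$ is strong if, when written in normal form, removing the constants does not lead to any cancellation among the variables, i.e. $w$ has no critical index. For $\sigma\in S_n$, $|\sigma|$ is the number of points not fixed by $\sigma$ (unnormalized Hamming norm). The Hamming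 distance is $d(\sigma,\tau)=|\sigma^{-1}\tau|$, and $\operatorname{diam}(S)=\max_{\sigma,\tau\in S}d(\sigma,\tau)$ for $\emptyset\ne S\subseteq S_n$. *)

(* Defs.v *)
From HB Require Import structures.
From mathcomp Require Import all_boot all_fingroup.

Set Implicit Arguments.
Unset Strict Implicit.
Unset Printing Implicit Defensive.

Import GroupScope.

(* The free product F_r * G is realised as the set of normal forms             *)
(*   c_0 x_i(1)^e(1) c_1 ... x_i(l)^e(l) c_l                                   *)
(* with the product given by concatenation followed by cancellation. The       *)
(* letter (i, b) stands for x_i if b is false and for x_i^-1 if b is true; the *)
(* normal form above is encoded as                                             *)
(*   (c_0, [:: (letter_1, c_1); ...; (letter_l, c_l)]).                        *)
(* The universal property is given by wlift_wcst, wlift_wvar and wlift_uniq;   *)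
(* normal_form_exists and normal_form_uniq state that every element is, in a   *)
(* unique way, the product described by a normal form.                         *)

Definition letter (r : nat) : Type := ('I_r * bool)%type.

Section Letters.
Variable r : nat.
Implicit Types a b : letter r.

Definition linv a : letter r := (a.1, ~~ a.2).

Definition cancelling a b : bool := (a.1 == b.1) && (a.2 != b.2).

Definition letter_val (H : groupType) (f : 'I_r -> H) a : H :=
  if a.2 then (f a.1)^-1 else f a.1.

Lemma cancellingP a b : reflect (b = linv a) (cancelling a b).
Proof.
case: a b => [i e] [j e']; rewrite /cancelling /linv /=.
apply: (iffP andP) => [[/eqP -> ne]|[-> ->]]; last by case: e.
by congr pair; case: e e' ne => [] [].
Qed.

Lemma linvK : involutive linv.
Proof. by case=> i e; rewrite /linv /= negbK. Qed.

Lemma cancelling_linv a : cancelling (linv a) a.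
Proof. by apply/cancellingP; rewrite linvK. Qed.

Lemma letter_val_linv (H : groupType) (f : 'I_r -> H) a :
  letter_val f (linv a) = (letter_val f a)^-1.
Proof. by case: a => i [] //=; rewrite /letter_val /= invgK. Qed.

End Letters.

Section WordsWithConstants.
Variables (r : nat) (G : groupType).

Definition rawword : Type := (G * seq (letter r * G))%type.

Definition admissible (u v : letter r * G) : bool :=
  ~~ (cancelling u.1 v.1 && (u.2 == 1)).

Definition normal_form (w : rawword) : bool := sorted admissible w.2.

Record wordc : Type := Wordc { wval : rawword; _ : normal_form wval }.

HB.instance Definition _ := [isSub for wval].
HB.instance Definition _ := [Choice of wordc by <:].

Definition lmulc (g : G) (v : rawword) : rawword := (g * v.1, v.2).

Definition lmull (a : letter r) (v : rawword) : rawword :=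
  if v.2 is (b, c) :: s then
    if cancelling a b && (v.1 == 1) then (c, s) else (1, (a, v.1) :: v.2)
  else (1, [:: (a, v.1)]).

Definition actl (s : seq (letter r * G)) (v : rawword) : rawword :=
  foldr (fun u v => lmull u.1 (lmulc u.2 v)) v s.

Definition mulraw (u v : rawword) : rawword := lmulc u.1 (actl u.2 v).

Definition invacc (v : rawword) (s : seq (letter r * G)) : rawword :=
  foldl (fun v u => lmulc u.2^-1 (lmull (linv u.1) v)) v s.

Definition invraw (u : rawword) : rawword := invacc (u.1^-1, [::]) u.2.

Lemma lmulc_nf g v : normal_form v -> normal_form (lmulc g v).
Proof. by []. Qed.

Lemma lmull_nf a v : normal_form v -> normal_form (lmull a v).
Proof.
case: v => c [|[b d] s] //=; rewrite /normal_form /lmull /= => nv.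
case: ifP => [_|nc] /=; first exact: path_sorted nv.
by rewrite nv andbT /admissible /= nc.
Qed.

Lemma actl_nf s v : normal_form v -> normal_form (actl s v).
Proof. by move=> nv; elim: s => //= u s IH; apply/lmull_nf/lmulc_nf. Qed.

Lemma mulraw_nf u v : normal_form v -> normal_form (mulraw u v).
Proof. by move=> nv; apply/lmulc_nf/actl_nf. Qed.

Lemma invacc_nf v s : normal_form v -> normal_form (invacc v s).
Proof. by elim: s v => //= u s IH v nv; apply/IH/lmulc_nf/lmull_nf. Qed.

Lemma lmulc1 v : lmulc 1 v = v.
Proof. by case: v => c s; rewrite /lmulc mul1g. Qed.

Lemma lmulcM g h v : lmulc (g * h) v = lmulc g (lmulc h v).
Proof. by rewrite /lmulc mulgA. Qed.

Lemma lmullK a v : normal_form v -> lmull (linv a) (lmull a v) = v.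
Proof.
case: v => c [|[b d] s]; rewrite /normal_form /lmull /=.
  by rewrite cancelling_linv eqxx.
case: ifP => [/andP[/cancellingP -> /eqP ->]|_ _] /=; last first.
  by rewrite cancelling_linv eqxx.
case: s => [|[b' d'] s] //= /andP[nc _].
by rewrite (negbTE nc).
Qed.

Lemma lmullVK a v : normal_form v -> lmull a (lmull (linv a) v) = v.
Proof. by move=> /(lmullK (linv a)); rewrite linvK. Qed.

Lemma mulraw_lmulc g u v : mulraw (lmulc g u) v = lmulc g (mulraw u v).
Proof. by rewrite /mulraw lmulcM. Qed.

Lemma mulraw_lmull a u v : normal_form v ->
  mulraw (lmull a u) v = lmull a (mulraw u v).
Proof.
move=> nv; case: u => c [|[b d] s]; rewrite /mulraw /=; first by rewrite lmulc1.
rewrite {1 2}/lmull /=.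
case: ifP => [/andP[/cancellingP -> /eqP ->]|_] /=; rewrite lmulc1 //.
by rewrite lmullVK //; apply/lmulc_nf/actl_nf.
Qed.

Lemma mulraw_actl s u v : normal_form v ->
  mulraw (actl s u) v = actl s (mulraw u v).
Proof.
by move=> nv; elim: s => //= x s IH; rewrite mulraw_lmull // mulraw_lmulc IH.
Qed.

Lemma mulraw_invacc s u v : normal_form v ->
  mulraw (invacc u s) v = invacc (mulraw u v) s.
Proof.
move=> nv; elim: s u => //= x s IH u.
by rewrite IH mulraw_lmulc mulraw_lmull.
Qed.

Lemma invacc_actl s v : normal_form v -> invacc (actl s v) s = v.
Proof.
move=> nv; elim: s => //= x s IH.
rewrite lmullK; last exact/lmulc_nf/actl_nf.
by rewrite -lmulcM mulVg lmulc1.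
Qed.

Lemma actl_normal s : sorted admissible s -> actl s (1, [::]) = (1, s).
Proof.
elim: s => //= -[a c] s IH ns; rewrite IH ?(path_sorted ns) //.
case: s ns {IH} => [|[b d] s] /=; first by rewrite /lmulc /lmull /= mulg1.
case/andP=> nc _; rewrite /lmulc /lmull /= mulg1.
by rewrite /admissible /= in nc; rewrite (negbTE nc).
Qed.

Lemma wval_nf (w : wordc) : normal_form (wval w).
Proof. exact: valP. Qed.

Definition wone : wordc := @Wordc (1, [::]) isT.

Definition wmul (u v : wordc) : wordc :=
  Wordc (mulraw_nf (wval u) (wval_nf v)).

Definition winv (u : wordc) : wordc :=
  @Wordc (invraw (wval u)) (@invacc_nf ((wval u).1^-1, [::]) _ isT).

Lemma wmulA : associative wmul.
Proof.
move=> u v w; apply: val_inj; rewrite /= [LHS]/mulraw [X in _ = mulraw X _]/mulraw.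
by rewrite mulraw_lmulc mulraw_actl ?wval_nf.
Qed.

Lemma wmul1 : right_id wone wmul.
Proof.
move=> u; apply: val_inj => /=; case: u => -[c s] /= ns.
by rewrite /mulraw /= actl_normal // /lmulc mulg1.
Qed.

Lemma w1mul : left_id wone wmul.
Proof. by move=> u; apply: val_inj; rewrite /= /mulraw lmulc1. Qed.

Lemma wmulV : left_inverse wone winv wmul.
Proof.
move=> u; apply: val_inj => /=; have nu := wval_nf u.
rewrite /invraw mulraw_invacc // /mulraw /=.
case: u nu => -[c s] /= _ ns.
by rewrite /lmulc mulVg -(actl_normal ns) invacc_actl.
Qed.

Lemma wmulgV : right_inverse wone winv wmul.
Proof.
move=> u; rewrite -[LHS]w1mul -(wmulV (winv u)) -wmulA.
by rewrite (wmulA (winv u)) wmulV w1mul wmulV.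
Qed.

HB.instance Definition _ :=
  isGroup.Build wordc wmulA w1mul wmul1 wmulV wmulgV.

Definition wcst (c : G) : wordc := @Wordc (c, [::]) isT.

Definition wvar (i : 'I_r) : wordc := @Wordc (1, [:: ((i, false), 1)]) isT.

Lemma wcstM : {morph wcst : c d / c * d}.
Proof. by move=> c d; apply: val_inj. Qed.

HB.instance Definition _ := isMultiplicative.Build G wordc wcst wcstM.

(* The homomorphism F_r * G -> H extending h : G -> H and x_i |-> f i.         *)
Definition wlift (H : groupType) (h : G -> H) (f : 'I_r -> H) (w : wordc) : H :=
  h (wval w).1 * \prod_(u <- (wval w).2) (letter_val f u.1 * h u.2).

Section Lift.
Variables (H : groupType) (h : {multiplicative G -> H}) (f : 'I_r -> H).

Let liftr (v : rawword) : H :=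
  h v.1 * \prod_(u <- v.2) (letter_val f u.1 * h u.2).

Let h1 : h 1 = 1.
Proof. by apply: (mulgI (h 1)); rewrite -gmulfM !mulg1. Qed.

Let liftr_lmulc g v : liftr (lmulc g v) = h g * liftr v.
Proof. by rewrite /liftr /= gmulfM mulgA. Qed.

Let liftr_lmull a v : liftr (lmull a v) = letter_val f a * liftr v.
Proof.
case: v => c [|[b d] s]; rewrite /liftr /lmull /=.
  by rewrite big_seq1 /= big_nil h1 mul1g mulg1.
case: ifP => [/andP[/cancellingP -> /eqP ->]|_] /=; last first.
  by rewrite !big_cons /= h1 mul1g !mulgA.
by rewrite big_cons /= h1 mul1g letter_val_linv !mulgA mulgV mul1g.
Qed.

Let liftr_actl s v :
  liftr (actl s v) = \prod_(u <- s) (letter_val f u.1 * h u.2) * liftr v.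
Proof.
elim: s => [|u s IH] /=; first by rewrite big_nil mul1g.
by rewrite liftr_lmull liftr_lmulc IH big_cons !mulgA.
Qed.

Lemma wliftM : {morph wlift h f : u v / u * v}.
Proof.
move=> u v; rewrite -[LHS]/(liftr (mulraw (wval u) (wval v))).
by rewrite liftr_lmulc liftr_actl mulgA.
Qed.

HB.instance Definition _ := isMultiplicative.Build wordc H (wlift h f) wliftM.

Lemma wlift_wcst c : wlift h f (wcst c) = h c.
Proof. by rewrite /wlift /= big_nil mulg1. Qed.

Lemma wlift_wvar i : wlift h f (wvar i) = f i.
Proof. by rewrite /wlift /= big_seq1 /= h1 mulg1 mul1g. Qed.

End Lift.

Lemma normal_form_exists (w : wordc) :
  w = wcst (wval w).1 * \prod_(u <- (wval w).2) (letter_val wvar u.1 * wcst u.2).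
Proof.
have var_lmull a v (nv : normal_form v) (nv' : normal_form (lmull a v)) :
    letter_val wvar a * Wordc nv = Wordc nv'.
  have pos i z (nz : normal_form z) (nz' : normal_form (lmull (i, false) z)) :
      wvar i * Wordc nz = Wordc nz'.
    by apply: val_inj; rewrite /= /mulraw /= !lmulc1.
  case: a nv' => i [] nv' /=; last exact: pos.
  rewrite /letter_val /=; apply: (mulgI (wvar i)); rewrite mulKVg.
  have nw := lmull_nf (i, false) nv'; rewrite (pos _ _ _ nw).
  by apply: val_inj; rewrite /= (lmullVK (i, false)).
case: w => -[c s] ns /=; have ns' : normal_form (1, s) by [].
suff -> : \prod_(u <- s) (letter_val wvar u.1 * wcst u.2) = Wordc ns'.
  by apply: val_inj; rewrite /= /mulraw /= /lmulc /= mulg1.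
elim: s {ns} ns' => [|[a d] s IH] ns; first by rewrite big_nil; apply: val_inj.
have ns1 : normal_form (1, s) by apply: path_sorted ns.
rewrite big_cons (IH ns1) /= -mulgA.
have nd : normal_form (d, s) by [].
have -> : wcst d * Wordc ns1 = Wordc nd.
  by apply: val_inj; rewrite /= /mulraw /= /lmulc /= mulg1.
rewrite (var_lmull _ _ _ (lmull_nf a nd)); apply: val_inj => /=.
have := actl_normal ns; rewrite /= actl_normal //.
by rewrite /lmulc /= mulg1.
Qed.

Lemma normal_form_uniq (c : G) (s : seq (letter r * G)) (w : wordc) :
    normal_form (c, s) ->
    w = wcst c * \prod_(u <- s) (letter_val wvar u.1 * wcst u.2) ->
  wval w = (c, s).
Proof. by move=> ns ->; rewrite -(normal_form_exists (Wordc ns)). Qed.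

Lemma wlift_uniq (H : groupType) (phi : {multiplicative wordc -> H}) w :
  phi w = wlift (phi \o wcst) (phi \o wvar) w.
Proof.
have phi1 : phi 1 = 1 by apply: (mulgI (phi 1)); rewrite -gmulfM !mulg1.
rewrite {1}(normal_form_exists w) /wlift gmulfM /=; congr (_ * _).
elim: (wval w).2 => [|[[i e] c] s IH]; first by rewrite !big_nil.
rewrite !big_cons !gmulfM IH; congr (_ * _ * _) => /=.
case: e => //; rewrite /letter_val /=; apply: (mulgI (phi (wvar i))).
by rewrite -gmulfM !mulgV.
Qed.

Definition word_map (w : wordc) (g : {ffun 'I_r -> G}) : G := wlift idfun g w.

Definition word_length (w : wordc) : nat := size (wval w).2.

(* c_j; c_0 is the leading constant. *)
Definition wconst (w : wordc) (j : nat) : G :=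
  nth 1 ((wval w).1 :: map snd (wval w).2) j.

(* x_i(j)^e(j), for 1 <= j <= l; hence the shift by one. *)
Definition wletter (w : wordc) (j : nat) : option (letter r) :=
  onth (map fst (wval w).2) j.-1.

Definition critical_index (w : wordc) (j : nat) : bool :=
  [&& 0 < j, j < word_length w &
    if (wletter w j, wletter w j.+1) is (Some a, Some b)
    then cancelling a b else false].

Definition wstrong (w : wordc) : Prop := forall j, ~~ critical_index w j.

End WordsWithConstants.

Arguments wcst {r G} c.
Arguments wvar {r G} i.

Fact unit_mulA : associative (fun _ _ : unit => tt). Proof. by []. Qed.
Fact unit_mul1 : left_id tt (fun _ _ : unit => tt). Proof. by case. Qed.
Fact unit_1mul : right_id tt (fun _ _ : unit => tt). Proof. by case. Qed.
Fact unit_mulV : left_inverse tt id (fun _ _ : unit => tt). Proof. by []. Qed.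
Fact unit_mulgV : right_inverse tt id (fun _ _ : unit => tt). Proof. by []. Qed.

HB.instance Definition _ :=
  isGroup.Build unit unit_mulA unit_mul1 unit_1mul unit_mulV unit_mulgV.

(* F_r as the free product of F_r with the trivial group: the normal forms     *)
(* are then exactly the reduced words.                                         *)
Definition free_group (r : nat) : groupType := wordc r unit.

Lemma free_group_lift (r : nat) (H : groupType) (f : 'I_r -> H) :
  exists phi : {multiplicative free_group r -> H},
    (forall i, phi (wvar i) = f i) /\
    (forall psi : {multiplicative free_group r -> H},
       (forall i, psi (wvar i) = f i) -> psi =1 phi).
Proof.
pose phi : {multiplicative free_group r -> H} := wlift (@one_fun unit H) f.
exists phi; split=> [i|psi psif w]; first exact: wlift_wvar.
have psi1 : psi 1 = 1 by apply: (mulgI (psi 1)); rewrite -gmulfM !mulg1.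
rewrite wlift_uniq /phi /= /wlift.
have E c : psi (wcst c) = 1 by case: c; rewrite -[RHS]psi1; congr (psi _); apply: val_inj.
rewrite /= E; congr (_ * _); apply: eq_bigr => -[[i e] c] _ /=.
by rewrite E /letter_val /= psif.
Qed.

Definition wcontent (r : nat) (G : groupType) : wordc r G -> free_group r :=
  wlift (@one_fun G (free_group r)) wvar.

Lemma wcontent_wcst (r : nat) (G : groupType) (c : G) :
  wcontent (wcst c : wordc r G) = 1.
Proof. exact: wlift_wcst. Qed.

Lemma wcontent_wvar (r : nat) (G : groupType) (i : 'I_r) :
  wcontent (wvar i : wordc r G) = wvar i.
Proof. exact: wlift_wvar. Qed.

Section Hamming.
Variable n : nat.
Implicit Types s t : 'S_n.

Definition hnorm s : nat := #|[set x | s x != x]|.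

(* Products in 'S_n are composed from left to right; the opposite convention   *)
(* gives the same distance, namely the number of x with s x != t x.            *)
Definition hdist s t : nat := hnorm (s^-1 * t).

Definition hdiam (S : {set 'S_n}) : nat :=
  \max_(s in S) \max_(t in S) hdist s t.

Definition word_image (r : nat) (w : wordc r 'S_n) : {set 'S_n} :=
  [set word_map w g | g : {ffun 'I_r -> 'S_n}].

End Hamming.

(* Main.v *)
(* Put m = D + 1 with D the diameter, and l the length of w. If 2ml < n and *)
(* every critical constant moves more than 2ml points, one builds a tuple g *)
(* greedily: choose m starting points one after the other and prescribe the *)
(* values of the g_i along their trajectories under w, each new value being *)
(* fresh and such that the next letter is applied to a point on which it is *)
(* still undetermined. Every step forbids at most 2ml points, and it only has *)
(* to be made inside the support of c_j when j is critical. The end points of *)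
(* the trajectories can be kept away from the values of w(1,...,1), so that *)
(* w(g) and w(1,...,1) differ at m > D points, a contradiction. *)
(* For (i), a critical constant moving at most 2ml points is deleted: this *)
(* keeps the content, shortens w by at least 2 and changes D + 1 by a factor *)
(* at most 5l. By induction n^2 <= 4 (D + 1)^2 (5l)^l. *)

Require Import Defs.
From mathcomp Require Import all_boot all_order all_fingroup zify.

(** A finite set of prescribed values of the [g_i] can be enlarged by one fresh value at a time
    ([commit_value]), so the trajectory of a point under [w] can be steered letter by letter. The
    only obstruction is a critical constant of small support: there the value just chosen already
    determines the next letter at that same point, unless the constant moves the point. Steering
    [hdiam + 1] points away from a fixed value of [w] ([commit_path], [separate_word_path])
    contradicts the definition of the diameter. Hence [small_critical_constant], the refined form of
    (ii); a strong word has no critical index, which gives (ii) itself. For (i),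
    [critical_index_remove] splits off a conjugate of the small constant, leaving a shorter word
    with the same content, and [hdiam_conj_perturb] controls the loss in diameter;
    [hdiam_content_bound] iterates this. *)

Lemma multiplicativeJ (G H : groupType) (phi : {multiplicative G -> H}) x y :
  (phi (x ^ y) = phi x ^ phi y)%g.
Proof. by apply: (mulgI (phi y)); rewrite -conjgC -!gmulfM -conjgC. Qed.

(** * Word length and deletion of a critical constant *)

Section WordLength.
Import GroupScope.
Variables (r : nat) (G : groupType).
Implicit Types w u v : wordc r G.

Lemma word_lengthM u v :
  word_length (u * v) <= word_length u + word_length v.
Proof.
rewrite /word_length /= /mulraw /=; elim: (wval u).2 => //= -[a c] s IH.
rewrite addSn; apply: leq_trans (leq_ltn_trans IH (ltnSn _)).
rewrite /lmull; case: (actl s (wval v)) => d [|[b e] t] //=.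
by case: ifP => //= _; apply: leq_trans (leqnSn _) (leqnSn _).
Qed.

Lemma word_length_prod (s : seq (letter r * G)) :
  word_length (\prod_(u <- s) (letter_val wvar u.1 * wcst u.2) : wordc r G)
    <= size s.
Proof.
elim: s => [|[a c] s IH]; first by rewrite big_nil.
rewrite big_cons; apply: leq_trans (word_lengthM _ _) _ => /=.
rewrite -add1n leq_add //; apply: leq_trans (word_lengthM _ _) _.
by rewrite addn0; case: a => i [].
Qed.

Lemma critical_index_split {w} {j : nat} : critical_index w j ->
  exists s1 s2 a d,
    (wval w).2 = s1 ++ (a, wconst w j) :: (linv a, d) :: s2.
Proof.
rewrite /critical_index; case/and3P; case: j => // j _.
rewrite /word_length /wletter /wconst /=.
elim: (wval w).2 j => [|[a c] s IH] [|j] //=.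
  case: s {IH} => [|[b d] s] //= _ /cancellingP ->.
  by exists [::], s, a, d.
move=> lt H; have [s1 [s2 [b [d Es]]]] := IH _ lt H.
by exists ((a, c) :: s1), s2, b, d; rewrite {1}Es.
Qed.

Lemma critical_index_remove {w} {j : nat} : critical_index w j ->
  exists w' u, w = w' * (wcst (wconst w j)) ^ u
    /\ (word_length w' + 2 <= word_length w)%N.
Proof.
move=> /critical_index_split [s1 [s2 [a [d ws]]]].
pose P s : wordc r G := \prod_(u <- s) (letter_val wvar u.1 * wcst u.2).
pose w' := wcst (wval w).1 * P s1 * (wcst d * P s2).
(* The conjugator is everything that follows [c_j] in [w], so the factor [a c_j a^-1] is moved to
   the right end; [w'] is [w] with that factor deleted. *)
exists w', ((letter_val wvar a)^-1 * (wcst d * P s2)); split.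
  rewrite [LHS]normal_form_exists ws big_cat !big_cons /= letter_val_linv.
  by rewrite /w' conjgE !invMg invgK !mulgA !(mulgKV, mulgK).
rewrite {2}/word_length ws size_cat /= addn2 !addnS !ltnS.
have cst c u : word_length (wcst c * u) <= word_length u.
  exact: leq_trans (word_lengthM _ _) _.
apply: leq_trans (word_lengthM _ _) _; apply: leq_add.
  exact: leq_trans (cst _ _) (word_length_prod _).
exact: leq_trans (cst _ _) (word_length_prod _).
Qed.

End WordLength.

(** * The Hamming norm on the symmetric group *)

Section Hamming.
Import GroupScope.
Variable n : nat.
Implicit Types s t : 'S_n.

Lemma hnormJ s t : hnorm (s ^ t) = hnorm s.
Proof.
rewrite /hnorm -[RHS](card_imset _ (@perm_inj _ t)); apply: eq_card => x.
rewrite inE; apply/idP/imsetP => [ne|[y]].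
  exists (t^-1 x); last by rewrite permKV.
  rewrite inE; apply: contraNneq ne => E.
  by rewrite conjgE !permM E permKV.
by rewrite inE => ne ->; rewrite permJ (inj_eq perm_inj).
Qed.

Lemma hnormM s t : hnorm (s * t) <= hnorm s + hnorm t.
Proof.
apply: leq_trans (leq_card_setU _ _).1; apply/subset_leq_card/subsetP => x.
by rewrite !inE permM; case: (eqVneq (s x) x) => [->|].
Qed.

Lemma hnormV s : hnorm s^-1 = hnorm s.
Proof.
apply: eq_card => x; rewrite !inE; congr negb.
by apply/eqP/eqP => E; rewrite -{1}E (permK, permKV).
Qed.

Lemma hdist_le_hdiam {S : {set 'S_n}} {s t : 'S_n} :
  s \in S -> t \in S -> (hdist s t <= hdiam S)%N.
Proof.
move=> sS tS; apply: leq_trans (leq_bigmax_cond _ sS).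
exact: (leq_bigmax_cond (F := fun t => hdist s t)) tS.
Qed.

End Hamming.

(** * Diameter of the image under a change of one constant *)

Section WordMap.
Import GroupScope.
Variables (r n : nat).
Implicit Types w : wordc r 'S_n.

Lemma word_map_in_image w g : word_map w g \in word_image w.
Proof. by apply/imsetP; exists g. Qed.

(** Each value of the word map is multiplied by a conjugate of [c], which has the same norm as [c];
    both ends of a distance are affected, whence the factor 2. *)
Lemma hdiam_conj_perturb (w u : wordc r 'S_n) (c : 'S_n) :
  hdiam (word_image w) <=
    hdiam (word_image (w * wcst c ^ u)) + (2 * hnorm c)%N.
Proof.
have wM g : word_map (w * wcst c ^ u) g = word_map w g * c ^ word_map u g.
  pose phi : {multiplicative wordc r 'S_n -> 'S_n} := wlift idfun g.
  change (phi (w * wcst c ^ u) = phi w * c ^ phi u).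
  rewrite gmulfM multiplicativeJ; congr (_ * _ ^ _); exact: wlift_wcst.
apply/bigmax_leqP => _ /imsetP[g _ ->]; apply/bigmax_leqP => _ /imsetP[h _ ->].
set w' := w * _ in wM *.
have := hdist_le_hdiam _ (word_map_in_image w' g) (word_map_in_image w' h).
rewrite /hdist => le; set a := word_map w g; set b := word_map w h.
have -> : a^-1 * b = c ^ word_map u g * ((word_map w' g)^-1 * word_map w' h)
            * (c ^ word_map u h)^-1.
  rewrite !wM -/a -/b.
  move: a b (c ^ word_map u g) (c ^ word_map u h) => a b x y.
  by rewrite invMg !mulgA mulgV mul1g mulgK.
apply: leq_trans (hnormM _ _ _) _; rewrite hnormV hnormJ.
rewrite mul2n -addnn addnA leq_add2r addnC.
by apply: leq_trans (hnormM _ _ _) _; rewrite hnormJ leq_add2l.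
Qed.

End WordMap.

(** * Greedy construction of a tuple along trajectories *)

Section Trajectories.
Import GroupScope.
Variables (r n : nat).
Implicit Types (g h : {ffun 'I_r -> 'S_n}) (a b : letter r).
Implicit Types (D E : letter r -> {set 'I_n}) (s : seq (letter r * 'S_n)).

(* D a collects the points p where the value of the letter a is prescribed; k *)
(* bounds the number of prescribed values. *)
Definition committed g D (k : nat) : Prop :=
  (forall a x, x \in D a -> letter_val g a x \in D (linv a)) /\
  (forall a, #|D a| <= k).

Definition extends g D h E : Prop :=
  forall a x, x \in D a -> x \in E a /\ letter_val h a x = letter_val g a x.

Lemma extends_refl g D : extends g D g D.
Proof. by []. Qed.

Lemma extends_trans {g D h E g' D'} :
  extends g D h E -> extends h E g' D' -> extends g D g' D'.
Proof. by move=> DE ED a x /DE[/ED[? ->] ->]. Qed.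

Lemma linv_neq a : linv a != a.
Proof. by case: a => i []; rewrite /linv /= xpair_eqE eqxx. Qed.

Lemma letter_base_eq a b : b.1 = a.1 -> (b == a) || (b == linv a).
Proof.
by case: a b => i e [j e'] /= ->; rewrite !xpair_eqE eqxx; case: e e' => [] [].
Qed.

(** Follow the permutation of [a] by the transposition of its old value at [p] with [q]. Neither
    transposed point is the image of a point of [D a], so all earlier commitments survive. *)
Lemma commit_value {g D} {k : nat} {a} {p q : 'I_n} :
  committed g D k -> p \notin D a -> q \notin D (linv a) ->
  exists h E, [/\ committed h E k.+1, extends g D h E, p \in E a,
    letter_val h a p = q &
    forall b, E b = if b == a then p |: D a
                    else if b == linv a then q |: D b else D b].
Proof.
move=> [gD Dk] pD qD; set t := tperm (letter_val g a p) q.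
pose f := letter_val g a * t.
pose h := [ffun j => if j == a.1 then if a.2 then f^-1 else f else g j].
pose E b := if b == a then p |: D a else if b == linv a then q |: D b else D b.
have ha : letter_val h a = f.
  by rewrite /letter_val ffunE eqxx; case: (a.2); rewrite ?invgK.
have hb b : b != a -> b != linv a -> letter_val h b = letter_val g b.
  move=> ba bv; rewrite /letter_val ffunE; case: eqP => // /letter_base_eq.
  by rewrite (negbTE ba) (negbTE bv).
have Da : E a = p |: D a by rewrite /E eqxx.
have Dv : E (linv a) = q |: D (linv a).
  by rewrite /E (negbTE (linv_neq a)) eqxx.
have fp : f p = q by rewrite permM tpermL.
have fD x : x \in D a -> f x = letter_val g a x.
  move=> xD; rewrite permM tpermD //.
    by rewrite (inj_eq perm_inj); apply: contraNneq pD => ->.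
  by apply: contraNneq qD => ->; apply: gD.
have fVD x : x \in D (linv a) -> f^-1 x = (letter_val g a)^-1 x.
  move=> xD; rewrite invMg permM tpermV tpermD //.
    apply: contraNneq pD => ax; have := gD _ _ xD.
    by rewrite linvK letter_val_linv -ax permK.
  by apply: contraNneq qD => ->.
exists h, E; split; rewrite ?ha ?Da ?setU11 //.
  split=> b; last first.
    rewrite -addn1 /E; case: eqP => [_|_].
      by rewrite cardsU1 pD addnC leq_add2r.
    case: eqP => [->|_]; last exact: leq_trans (Dk b) (leq_addr _ _).
    by rewrite cardsU1 qD addnC leq_add2r.
  have [Eb|ba] := eqVneq b a => x.
    rewrite Eb Da Dv ha !inE => /orP[/eqP->|xD]; first by rewrite fp eqxx.
    by rewrite fD // gD ?orbT.
  have [Eb|bv] := eqVneq b (linv a).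
    rewrite Eb Dv linvK Da letter_val_linv ha !inE => /orP[/eqP->|xD].
      by rewrite -fp permK eqxx.
    rewrite fVD // -letter_val_linv; have := gD _ _ xD.
    by rewrite linvK => ->; rewrite orbT.
  have bva : linv b != a by apply: contraNneq bv => <-; rewrite linvK.
  have bva' : linv b != linv a by rewrite (inj_eq (can_inj (@linvK r))).
  rewrite hb // /E (negbTE ba) (negbTE bv) (negbTE bva) (negbTE bva').
  exact: gD.
move=> b x xD; have [Eb|ba] := eqVneq b a.
  by move: xD; rewrite Eb Da ha inE => xD; rewrite xD orbT fD.
have [Eb|bv] := eqVneq b (linv a).
  by move: xD; rewrite Eb Dv !letter_val_linv ha inE => xD; rewrite xD orbT fVD.
by rewrite hb // /E (negbTE ba) (negbTE bv).
Qed.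

Lemma fresh_point (A B : {set 'I_n}) :
  #|B| < #|A| -> exists2 q, q \in A & q \notin B.
Proof.
move=> lt; have /subsetPn[q]: ~~ (A \subset B).
  by apply: contraL lt => /subset_leq_card; rewrite leqNgt.
by exists q.
Qed.

Definition word_path g s (p : 'I_n) : 'I_n :=
  (\prod_(u <- s) (letter_val g u.1 * u.2)) p.

Lemma word_path_cons g u s p :
  word_path g (u :: s) p = word_path g s (u.2 (letter_val g u.1 p)).
Proof. by rewrite /word_path big_cons !permM. Qed.

(** Induction along the word: each letter adds one commitment, and fewer than [M] points are
    forbidden for its value. The end point is controlled for all later extensions, so further
    trajectories cannot spoil it. *)
Lemma commit_path {M k : nat} {a} {c : 'S_n} {s g D} {p} (t : 'I_n) :
  M <= n -> (2 * (k + (size s).+1) <= M)%N ->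
  path (fun u v => cancelling u.1 v.1 ==> (M < hnorm u.2)) (a, c) s ->
  committed g D k -> p \notin D a ->
  exists h E, [/\ committed h E (k + (size s).+1), extends g D h E, p \in E a &
    forall h' E', extends h E h' E' -> word_path h' ((a, c) :: s) p != t].
Proof.
move=> Mn; elim: s a c k g D p => [|[b d] s IH] a c k g D p kM /=.
  move=> _ cD pD; have [gD Dk] := cD.
  (* At the last letter only the end point [t] and the values already taken by [a] are to be
     avoided. *)
  have [|q _] := @fresh_point setT (c^-1 t |: D (linv a)).
    rewrite cardsT card_ord cardsU1; have := Dk (linv a).
    by case: (_ \notin _) => /=; rewrite /= in kM; lia.
  rewrite !inE negb_or => /andP[qt qD].
  have [h [E [cE ext pE hp _]]] := commit_value cD pD qD.
  exists h, E; split=> //; first by rewrite addn1.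
  move=> h' E' /(_ a p pE)[_].
  rewrite word_path_cons /word_path big_nil perm1 /= => ->.
  by rewrite hp; apply: contraNneq qt => <-; rewrite permK.
case/andP=> crit ps cD pD; have [gD Dk] := cD.
(* [B] holds at most [2 * k + 1] points. At a critical constant [q] must also be moved by [c], as
   committing [p] to [q] puts [q] into the domain of [b]. *)
pose S := if cancelling a b then [set x | c x != x] else setT.
pose B := D (linv a) :|: c @^-1: (p |: D b).
have [|q qS] := @fresh_point S B.
  have ltS : M <= #|S|.
    rewrite /S; case: (cancelling a b) crit => /=; first exact: ltnW.
    by rewrite cardsT card_ord.
  have := (leq_card_setU (D (linv a)) (c @^-1: (p |: D b))).1.
  rewrite -/B (card_preimset _ (@perm_inj _ c)) cardsU1.
  by move: kM (Dk (linv a)) (Dk b) ltS => /=; case: (p \notin D b) => /=; lia.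
rewrite !inE !negb_or => /and3P[qD cqp cqD].
have [h [E [cE ext pE hp EE]]] := commit_value cD pD qD.
(* The new commitment enlarges the domain of [b] by [p] if [b] is [a], and by [q] if [b] is its
   inverse. *)
have cqE : c q \notin E b.
  rewrite EE; case: eqP => [ba|_]; first by rewrite !inE negb_or cqp -ba.
  case: eqP => [ba|_] //; rewrite !inE negb_or cqD andbT.
  by move: qS; rewrite /S (introT (cancellingP a b) ba) inE.
have [|h2 [E2 [cE2 ext2 cqE2 tE2]]] := IH b d k.+1 h E (c q) _ ps cE cqE.
  by move: kM => /=; lia.
exists h2, E2; split.
- by rewrite addnS -addSn.
- exact: extends_trans ext ext2.
- by have [] := ext2 a p pE.
move=> h' E' ext'; rewrite word_path_cons /=.
have [_ ->] := extends_trans ext2 ext' _ _ pE.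
by rewrite hp (tE2 h' E').
Qed.

Lemma separate_word_path (M m : nat) (c0 t : 'S_n) s :
  s != [::] -> M < n -> (2 * (m * size s) <= M)%N ->
  sorted (fun u v => cancelling u.1 v.1 ==> (M < hnorm u.2)) s ->
  exists g, m <= hdist t (c0 * \prod_(u <- s) (letter_val g u.1 * u.2)).
Proof.
case: s => [//|[a c] s] _ Mn; set s' := _ :: s => mM srt.
suff [g [D [Z [_ Zm _ gZ]]]] : exists g D (Z : {set 'I_n}),
    [/\ committed g D (m * size s'), #|Z| = m,
      forall z, z \in Z -> c0 z \in D a &
      forall h E z, z \in Z -> extends g D h E ->
        word_path h s' (c0 z) != t z].
  exists g; rewrite -Zm -(card_imset _ (@perm_inj _ t)).
  apply/subset_leq_card/subsetP => _ /imsetP[z zZ ->].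
  by rewrite inE permM permK permM; apply: gZ zZ (extends_refl g D).
elim: m mM => [|m IH] mM.
  exists [ffun=> 1], (fun=> set0), set0; split; rewrite ?cards0 //.
    by split=> b; rewrite ?cards0 // => x; rewrite inE.
  by move=> z; rewrite inE.
  by move=> h E z; rewrite inE.
have [|g [D [Z [cD Zm ZD gZ]]]] := IH; first by move: mM; rewrite mulSn; lia.
(* Since the first letter is already committed at [c0 x] for every [x] in [Z], such a [z] is
   automatically outside [Z]. *)
have [|z _] := @fresh_point setT (c0 @^-1: D a).
  rewrite cardsT card_ord (card_preimset _ (@perm_inj _ c0)).
  by case: cD => _ /(_ a); move: mM; rewrite mulSn; lia.
rewrite inE => zD.
have [|h [E [cE ext zE tE]]] := commit_path (t z) (ltnW Mn) _ srt cD zD.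
  by move: mM; rewrite mulSn /=; lia.
exists h, E, (z |: Z); split.
- by rewrite mulSn addnC.
- rewrite cardsU1 Zm; suff -> : z \notin Z by rewrite add1n.
  by apply: contra zD; apply: ZD.
- by move=> x; rewrite inE => /orP[/set1P->|/ZD/ext[]].
move=> h' E' x; rewrite inE => /orP[/set1P->|xZ] ext'; first exact: tE ext'.
exact: gZ xZ (extends_trans ext ext').
Qed.

End Trajectories.

(** * Small critical constants and the induction on length *)

Section Diameter.
Import GroupScope.
Variables (r n : nat).
Implicit Types w : wordc r 'S_n.

Lemma critical_index_nth (w : wordc r 'S_n) (i : nat) x0 :
  i.+1 < word_length w ->
  cancelling (nth x0 (wval w).2 i).1 (nth x0 (wval w).2 i.+1).1 ->
  critical_index w i.+1 /\ wconst w i.+1 = (nth x0 (wval w).2 i).2.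
Proof.
rewrite /critical_index /wletter /wconst /word_length => lt canc.
rewrite lt !onthE -!map_comp !succnK !(nth_map x0) ?(ltnW lt) //=.
by rewrite (nth_map x0) ?(ltnW lt).
Qed.

Lemma small_critical_constant w :
  0 < word_length w ->
  (2 * (hdiam (word_image w) + 1) * word_length w < n)%N ->
  exists j, critical_index w j /\
    hnorm (wconst w j) <= (2 * (hdiam (word_image w) + 1) * word_length w)%N.
Proof.
move=> l0; set M := (2 * _ * _)%N => Mn.
pose e (u v : letter r * 'S_n) := cancelling u.1 v.1 ==> (M < hnorm u.2).
have s0 : (wval w).2 != [::] by rewrite -size_eq0 -lt0n.
have [srt|nsrt] := boolP (sorted e (wval w).2).
  (* The reference permutation is the value of [w] at the trivial tuple, so two values of [w] would
     lie further apart than the diameter. *)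
  have [|g] := @separate_word_path r n M (hdiam (word_image w) + 1) (wval w).1
      (word_map w [ffun=> 1]) _ s0 Mn _ srt.
    by rewrite /M mulnA.
  have := hdist_le_hdiam _ (word_map_in_image _ _ w [ffun=> 1])
    (word_map_in_image _ _ w g).
  by rewrite addn1 => le lt; have := leq_ltn_trans le lt; rewrite ltnn.
have [x0 _] : exists x0, x0 \in (wval w).2.
  by case: (wval w).2 s0 => // x s _; exists x; rewrite mem_head.
have /existsP[i /andP[lt]] : [exists i : 'I_(word_length w),
    (i.+1 < word_length w) &&
    ~~ e (nth x0 (wval w).2 i) (nth x0 (wval w).2 i.+1)].
  apply: contraR nsrt => /existsPn H; apply/(sortedP x0) => i lt.
  by have := H (Ordinal (ltnW lt)); rewrite /= lt negbK.
rewrite negb_imply -leqNgt => /andP[canc le].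
have [crit wj] := critical_index_nth w _ x0 lt canc.
by exists i.+1; split; last by rewrite wj.
Qed.

Lemma word_length_gt0 w : ~ (exists c, w = wcst c) -> 0 < word_length w.
Proof.
move=> nc; rewrite lt0n size_eq0; apply/eqP => s0; apply: nc.
by exists (wval w).1; rewrite {1}(normal_form_exists w) s0 big_nil mulg1.
Qed.

(** Squaring turns (i) into an inequality of natural numbers, proved by strong induction on the
    length. *)
Lemma hdiam_content_bound w : wcontent w <> 1 ->
  (n ^ 2 <= 4 * (hdiam (word_image w) + 1) ^ 2 *
    (5 * word_length w) ^ word_length w)%N.
Proof.
have [N] := ubnP (word_length w); elim: N => // N IH in w * => ltN nt.
have l0 : 0 < word_length w.
  apply: word_length_gt0 => -[c wc]; apply: nt.
  by rewrite wc; exact: wcontent_wcst.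
set D := hdiam _; set l := word_length w.
have [le|lt] := leqP n (2 * (D + 1) * l).
  have ll : (l ^ 2 <= (5 * l) ^ l)%N.
    have [l1|l1] := leqP l 1; first by have -> : l = 1%N by lia.
    apply: leq_trans (leq_pexp2l _ l1); last by lia.
    by rewrite leq_exp2r //; lia.
  apply: (@leq_trans ((2 * (D + 1) * l) ^ 2)%N); first by rewrite leq_exp2r.
  by rewrite expnMn leq_mul // expnMn.
have [j [crit cj]] := small_critical_constant _ l0 lt.
have [w' [u [Ew lw']]] := critical_index_remove _ _ crit.
have cont : wcontent w' <> 1.
  move=> w'1; apply: nt; rewrite Ew.
  pose phi : {multiplicative wordc r 'S_n -> free_group r} :=
    wlift (@one_fun 'S_n (free_group r)) wvar.
  change (phi (w' * wcst (wconst w j) ^ u) = 1).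
  have phi1 : phi (wcst (wconst w j)) = 1 by exact: wcontent_wcst.
  by rewrite gmulfM multiplicativeJ phi1 conj1g mulg1; exact: w'1.
have lN : word_length w' < N by move: lw' ltN; lia.
have := IH w' lN cont.
have := hdiam_conj_perturb _ _ w' u (wconst w j).
rewrite -Ew -/D; set D' := hdiam _; set l' := word_length w' in lw' *.
move=> DD' IHw.
(* Deleting [c_j] costs at most [4 * (D + 1) * l] in diameter, and [1 + 4 * l <= 5 * l]. *)
have DD : (D' + 1 <= (D + 1) * (5 * l))%N by nia.
apply: leq_trans IHw _.
have -> : ((5 * l) ^ l = (5 * l) ^ 2 * (5 * l) ^ (l - 2))%N.
  by rewrite -expnD subnKC //; lia.
(* The two letters lost by [w'] pay for the factor [(5 * l) ^ 2]. *)
apply: (@leq_trans (4 * ((D + 1) * (5 * l)) ^ 2 * (5 * l) ^ (l - 2))%N);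
  last first.
  by rewrite (expnMn (D + 1)) !mulnA.
apply: leq_mul.
  by rewrite leq_mul2l leq_exp2r.
have [->|l'0] := posnP l'; first by rewrite expn0 expn_gt0; lia.
apply: (@leq_trans ((5 * l) ^ l')%N); first by rewrite leq_exp2r //; lia.
by apply: leq_pexp2l; lia.
Qed.

End Diameter.

(* Passage to real numbers *)
From mathcomp Require Import all_algebra.
From mathcomp Require Import all_classical all_reals all_analysis ring.

Import Order.TTheory GRing.Theory Num.Theory.
Local Open Scope ring_scope.

Theorem theorem1 (R : realType) (n r : nat) (hn : (1 <= n)%N) (hr : (1 <= r)%N)
    (w : wordc r 'S_n) :
  (wcontent w <> 1%g ->
     1 / 2 * expR (- ln (5 * (word_length w)%:R) * (word_length w)%:R / 2)
       <= ((hdiam (word_image w))%:R + 1) / n%:R :> R)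
  /\
  (wstrong w -> ~ (exists c : 'S_n, w = wcst c) ->
     1 / (2 * (word_length w)%:R) <= ((hdiam (word_image w))%:R + 1) / n%:R :> R)
  /\
  (~ (exists c : 'S_n, w = wcst c) ->
     ((hdiam (word_image w))%:R + 1) / n%:R < 1 / (2 * (word_length w)%:R) :> R ->
     exists j : nat, critical_index w j /\
       (hnorm (wconst w j) <= 2 * (hdiam (word_image w) + 1) * word_length w)%N).
Proof.
set D := hdiam _; set l := word_length w.
have n0 : 0 < n%:R :> R by rewrite ltr0n.
have iii : ~ (exists c : 'S_n, w = wcst c) ->
    (D%:R + 1) / n%:R < 1 / (2 * l%:R) :> R ->
    exists j : nat, critical_index w j /\
      (hnorm (wconst w j) <= 2 * (D + 1) * l)%N.
  move=> nc lt; have l0 := word_length_gt0 _ _ _ nc.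
  apply: small_critical_constant => //; move: lt.
  rewrite ltr_pdivrMr // mulrAC mul1r ltr_pdivlMr ?mulr_gt0 ?ltr0n //.
  have -> : (D%:R + 1) * (2 * l%:R) = (2 * (D + 1) * l)%:R :> R.
    by rewrite !natrM natrD; ring.
  by rewrite ltr_nat.
split; last split=> //.
  move=> nt; have := hdiam_content_bound _ _ _ nt; rewrite -/D -/l => le.
  have l0 : 0 < l%:R :> R.
    rewrite ltr0n word_length_gt0 // => -[c wc]; apply: nt.
    by rewrite wc; exact: wcontent_wcst.
  set E := expR _.
  (* The exponential is the inverse square root of [(5 * l) ^ l], so squaring the claim leads back
     to [hdiam_content_bound]. *)
  have E2 : E ^+ 2 * (5 * l%:R) ^+ l = 1.
    rewrite -expRM_natl mulrC -{1}[5 * l%:R]lnK ?posrE ?mulr_gt0 //.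
    by rewrite -expRM_natl -expRD -[RHS]expR0; congr expR; field.
  have P0 : 0 < 4 * (5 * l%:R) ^+ l :> R.
    by rewrite mulr_gt0 ?exprn_gt0 ?mulr_gt0.
  have E0 : 0 <= 1 / 2 * E * n%:R.
    by rewrite !mulr_ge0 ?expR_ge0 ?ler0n ?invr_ge0.
  rewrite ler_pdivlMr // -(@ler_pXn2r _ 2) ?nnegrE ?addr_ge0 ?ler0n //.
  rewrite -(ler_pM2r P0).
  have -> : (1 / 2 * E * n%:R) ^+ 2 * (4 * (5 * l%:R) ^+ l) = (n ^ 2)%:R.
    transitivity (E ^+ 2 * (5 * l%:R) ^+ l * n%:R ^+ 2); first by field.
    by rewrite E2 mul1r natrX.
  have -> : (D%:R + 1) ^+ 2 * (4 * (5 * l%:R) ^+ l)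
      = (4 * (D + 1) ^ 2 * (5 * l) ^ l)%:R :> R.
    by rewrite !natrM !natrX natrM natrD; ring.
  by rewrite ler_nat.
move=> st nc; rewrite leNgt; apply/negP => /(iii nc)[j [crit _]].
by have := st j; rewrite crit.
Qed.
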